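(* Let $S$ be a bilateral weighted shift on a complex Hilbert space $\mathcal{H}$ with orthonormal basis $(e_n)_{n\in\mathbb{Z}}$ and bounded weight sequence $(\omega_n)_{n\in\mathbb{Z}}$ of positive real numbers, i.e. $Se_n=\omega_n e_{n+1}$ for all $n\in\mathbb{Z}$. Assume that $r_2^-(S)=0$. Let $k\in\mathbb{Z}$ and let $\mathcal{H}_k^+$ be the closed linear span of $\{e_n:n\ge k\}$. Then for every non-zero $x\in\mathcal{H}_k^+$: (a) If $r_3^+(S)<R_\omega^+(x)$, then $\sigma_S(x)=\{\lambda\in\mathbb{C}:|\lambda|\le r_3^+(S)\}$. (b) If $r_3^+(S)\ge R_\omega^+(x)$, then $\{\lambda\in\mathbb{C}:|\lambda|\le R_\omega^+(x)\}\subset\sigma_S(x)$.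
   Context: Put $\beta_n=\omega_0\cdots\omega_{n-1}$ for $n>0$, $\beta_0=1$, and $\beta_n=\frac{1}{\omega_n\cdots\omega_{-1}}$ for $n<0$. Define $r_2^-(S)=\liminf_{n\to+\infty}[1/\beta_{-n}]^{1/n}$ and $r_3^+(S)=\limsup_{n\to+\infty}\beta_n^{1/n}$. For non-zero $x=\sum_{n\in\mathbb{Z}}a_ne_n\in\mathcal{H}$ define $R_\omega^+(x)=\liminf_{n\to+\infty}|\beta_n/a_n|^{1/n}\in[0,+\infty]$, with the convention that $|\beta_n/a_n|^{1/n}=+\infty$ when $a_n=0$. For a bounded linear operator $T$ on $\mathcal{H}$ and $x\in\mathcal{H}$, the local resolvent set $\rho_T(x)$ is the union of all open $U\subset\mathbb{C}$ for which there is an analytic $f:U\to\mathcal{H}$ with $(T-\lambda)f(\lambda)=x$ for all $\lambda\in U$; the local spectrum is $\sigma_T(x)=\mathbb{C}\setminus\rho_T(x)$. *)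

(* Defs.v *)
From HB Require Import structures.
From mathcomp Require Import all_boot all_order all_algebra.
From mathcomp Require Import complex.
From mathcomp Require Import all_classical all_reals all_analysis.

Set Implicit Arguments.
Unset Strict Implicit.
Unset Printing Implicit Defensive.

Import Order.TTheory GRing.Theory Num.Theory.
Import numFieldNormedType.Exports.

Local Open Scope classical_set_scope.
Local Open Scope ring_scope.
Local Open Scope complex_scope.

Section HilbertSpace.
Variables (R : realType) (H : completeNormedModType R[i]).

Definition linear_span (A : set H) : set H :=
  [set x | exists (n : nat) (c : 'I_n -> R[i]) (v : 'I_n -> H),
     (forall i, A (v i)) /\ x = \sum_(i < n) c i *: v i].

Definition closed_span (A : set H) : set H := closure (linear_span A).

(* A form [{dot H for Num.conj}] is linear in its first argument and positive
   definite; requiring it to induce the norm of the Banach space [H] makes [H]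
   a complex Hilbert space. *)
Definition inner_product (dot : {dot H for Num.conj}) : Prop :=
  forall x : H, dot x x = `|x| ^+ 2.

Definition orthonormal_basis (dot : {dot H for Num.conj}) (e : int -> H) :
  Prop :=
  (forall m n : int, dot (e m) (e n) = (m == n)%:R) /\
  closed_span (range e) = setT.

(* The sets of complex numbers are over [R[i]^o], the type which carries the
   topology of the complex plane. *)
Definition analytic_on (U : set R[i]^o) (f : R[i]^o -> H) : Prop :=
  forall l0, U l0 -> exists c : nat -> H,
    \forall l \near l0, series (fun n => (l - l0) ^+ n *: c n) @ \oo --> f l.

Definition local_resolvent_set (T : H -> H) (x : H) : set R[i]^o :=
  \bigcup_(U in [set U : set R[i]^o | open U /\
      exists f : R[i]^o -> H, analytic_on U f /\
        forall l, U l -> T (f l) - l *: f l = x]) U.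

Definition local_spectrum (T : H -> H) (x : H) : set R[i]^o :=
  ~` local_resolvent_set T x.

Definition bilateral_weighted_shift (e : int -> H) (w : int -> R)
    (S : {linear H -> H}) : Prop :=
  continuous S /\ forall n : int, S (e n) = (w n)%:C *: e (n + 1).

End HilbertSpace.

Section Weights.
Variables (R : realType) (w : int -> R).

(* [Negz m] is the integer -(m+1), so the product in the second case is
   w_(-(m+1)) ... w_(-1). *)
Definition wbeta (n : int) : R :=
  match n with
  | Posz m => \prod_(j < m) w j%:Z
  | Negz m => (\prod_(j < m.+1) w (- (j.+1)%:Z))^-1
  end.

Definition r2_minus : \bar R :=
  limn_einf (fun n : nat => ((1 / wbeta (- n%:Z)) `^ n%:R^-1)%:E).

Definition r3_plus : \bar R :=
  limn_esup (fun n : nat => (wbeta n%:Z `^ n%:R^-1)%:E).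

(* [R_plus dot e x] is R_w^+(x): the n-th coordinate of [x] in an orthonormal
   basis [e] is [dot x (e n)]. *)
Definition R_plus (H : completeNormedModType R[i])
    (dot : {dot H for Num.conj}) (e : int -> H) (x : H) : \bar R :=
  limn_einf (fun n : nat =>
    if dot x (e n%:Z) == 0 then +oo%E
    else (Normc.normc ((wbeta n%:Z)%:C / dot x (e n%:Z)) `^ n%:R^-1)%:E).

End Weights.

Definition closed_disc (R : realType) (r : \bar R) : set R[i]^o :=
  [set l | ((Normc.normc l)%:E <= r)%E].

(* Main.v *)
Require Import Defs.
From mathcomp Require Import all_boot all_order all_algebra.
From mathcomp Require Import complex.
From mathcomp Require Import all_classical all_reals all_analysis.
From mathcomp Require Import zify ring lra.

Import Order.TTheory GRing.Theory Num.Theory.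
Import numFieldNormedType.Exports.

Local Open Scope classical_set_scope.
Local Open Scope ring_scope.

(** Write the [n]-th coordinate of a vector [y] as [beta_n * Y_n].  In these
    normalized coordinates the equation [S y - l y = x] is the two-term
    recursion [Y_(n-1) - l Y_n = X_n] ([ncoord_shift]), and everything is read
    off from it.

    Since [beta_n |Y_n|] is at most the norm of [y], while [r2_minus w = 0] makes
    [beta_(-n)] exceed every geometric sequence along a subsequence, a solution
    for [l != 0] cannot have coordinates to the left of the support of [x]
    ([ncoord_left0]).  So it is unique ([solution_unique]), and solving the
    recursion from the left end of the support yields
    [l ^ (n+1) Y_n = - sum_(m <= n) X_m l ^ m] ([ncoord_solution]).

    The disc is in the local spectrum.  Write [R_plus x] for
    [R_plus w dot e x], let [0 < |l| < min (r3_plus w) (R_plus x)] and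
    let [y] solve the equation.  The ratio [beta_n / |l| ^ n] is unbounded, so
    the partial sums above are arbitrarily small infinitely often; as the power
    series [sum X_m l ^ m] converges below [R_plus x], its sum at [l] is [0]
    ([pser_xcoef_vanish]).  If this happens for all [l] in an open set, the
    identity theorem gives [X = 0], hence [x = 0] ([identity_theorem]).  The
    closed disc follows because the local resolvent set is open: a point of the
    closed disc other than [0] in that set has near it a small ball, contained in
    the set and in the punctured open disc.  At [l = 0] one uses that a local
    solution [f] is bounded near [0]: then [l] times any fixed coordinate of
    [f l] tends to [0], and the recursion kills the [X_n] one after another
    ([bounded_at0_eq0]).

    Conversely let [r3_plus w < R_plus x] and [|l| > r3_plus w], and take [rho]
    with [r3_plus w < rho < min |l| (R_plus x)].  Then [|X_n| <= C rho ^ (-n)],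
    the recursion turns this bound into the same one for [Y] with constant
    [C / (|l| - rho)] ([resolvent_seq_le]), and sequences with such a bound are
    the normalized coordinates of vectors because [beta_n] grows more slowly than
    [rho ^ n] ([decaying_vector]).  Iterating the solution operator produces the
    Taylor coefficients of the solution around [l], whose norms grow at most like
    the powers of [1 / (|l| - rho)]; so the solution is analytic
    ([decays_analytic]). *)

(** * The norm of a complex Banach space as a real number *)

Section RealNorm.
Context {R : realType} {H : completeNormedModType R[i]}.
Implicit Types (y z : H) (a : R[i]) (u : nat -> H).

(** Norms on a space over [R[i]] are complex numbers with zero imaginary part;
    taking the real part makes real arithmetic available for estimates. *)
Definition rnorm (y : H) : R := complex.Re `|y|.

Lemma rnormE y : `|y| = (rnorm y)%:C%C.
Proof. by rewrite /rnorm RRe_real// ger0_real. Qed.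

Lemma normc_normE a : `|a| = (Normc.normc a)%:C%C.
Proof. by case: a => x y; rewrite normc_def. Qed.

Lemma rnorm_ge0 y : 0 <= rnorm y.
Proof. by rewrite -ler0c -rnormE. Qed.

Lemma normc_ge0 a : 0 <= Normc.normc a.
Proof. by rewrite -ler0c -normc_normE. Qed.

Lemma rnorm0 : rnorm 0 = 0.
Proof. by rewrite /rnorm normr0. Qed.

Lemma rnorm_eq0 y : (rnorm y == 0) = (y == 0).
Proof. by rewrite -[RHS]normr_eq0 rnormE -(inj_eq (@complexI R)). Qed.

Lemma rnormD y z : rnorm (y + z) <= rnorm y + rnorm z.
Proof. by rewrite -lecR rmorphD/= -!rnormE ler_normD. Qed.

Lemma rnormN y : rnorm (- y) = rnorm y.
Proof. by rewrite /rnorm normrN. Qed.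

Lemma rnormZ a y : rnorm (a *: y) = Normc.normc a * rnorm y.
Proof. by apply: (@complexI R); rewrite rmorphM/= -!rnormE -normc_normE normrZ. Qed.

Lemma normcX a n : Normc.normc (a ^+ n) = Normc.normc a ^+ n.
Proof. by apply: (@complexI R); rewrite rmorphXn/= -!normc_normE normrX. Qed.

Lemma normcB a b : Normc.normc (a - b) <= Normc.normc a + Normc.normc b.
Proof. by rewrite -lecR rmorphD/= -!normc_normE ler_normB. Qed.

Lemma normc_real (r : R) : Normc.normc r%:C%C = `|r|.
Proof. by apply: (@complexI R); rewrite -normc_normE normc_def /= expr0n addr0 sqrtr_sqr. Qed.

Lemma normc_eq0 a : (Normc.normc a == 0) = (a == 0).
Proof. by rewrite -[RHS]normr_eq0 normc_normE -(inj_eq (@complexI R)). Qed.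

Lemma cvg_rnormP u y : u @ \oo --> y <->
  forall eps : R, 0 < eps -> \forall n \near \oo, rnorm (y - u n) < eps.
Proof.
split.
  move=> /cvgrPdist_lt uy eps eps0.
  have := uy eps%:C%C; rewrite ltcR => /(_ eps0); apply: filterS => n.
  by rewrite rnormE ltcR.
move=> uy; apply/cvgrPdist_lt => eps eps0.
have epsE : eps = (complex.Re eps)%:C%C by rewrite RRe_real// gtr0_real.
have := uy (complex.Re eps); rewrite -ltcR -epsE => /(_ eps0).
by apply: filterS => n; rewrite epsE rnormE ltcR.
Qed.

Lemma rnorm_lim u y (C : R) : u @ \oo --> y ->
  (\forall n \near \oo, rnorm (u n) <= C) -> rnorm y <= C.
Proof.
move=> /cvg_rnormP uy uC; apply/ler_addgt0Pr => eps eps0.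
have [n [une unC]] : exists n, rnorm (y - u n) < eps /\ rnorm (u n) <= C.
  near \oo => n; exists n; split; near: n => //; exact: uy.
rewrite -[y](subrK (u n)) (le_trans (rnormD _ _))// addrC lerD// ltW//.
Unshelve. all: by end_near. Qed.

Lemma cvg_rnorm0 u (v : nat -> R) : (forall n, rnorm (u n) <= v n) ->
  v @ \oo --> 0 -> u @ \oo --> 0.
Proof.
move=> uv /cvgrPdist_lt v0; apply/cvg_rnormP => eps eps0.
have := v0 eps eps0; apply: filterS => n; rewrite !sub0r normrN rnormN.
by move=> h; rewrite (le_lt_trans (uv n))// (le_lt_trans (ler_norm _)).
Qed.

Lemma rnorm_sum (I : Type) (r : seq I) (P : pred I) (F : I -> H) :
  rnorm (\sum_(i <- r | P i) F i) <= \sum_(i <- r | P i) rnorm (F i).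
Proof.
elim/big_rec2: _ => [|i x y _ h]; first by rewrite rnorm0.
by rewrite (le_trans (rnormD _ _))// lerD2l.
Qed.

Lemma geometric_sum_le (q : R) m n : 0 <= q < 1 ->
  \sum_(m <= i < n) q ^+ i <= q ^+ m / (1 - q).
Proof.
move=> /andP[q0 q1].
have q1' : 0 < 1 - q by lra.
rewrite ler_pdivlMr//.
have [nm|mn] := leqP n m; first by rewrite big_geq// mul0r exprn_ge0.
suff -> : (\sum_(m <= i < n) q ^+ i) * (1 - q) = q ^+ m - q ^+ n.
  by rewrite gerBl exprn_ge0.
elim: n mn => // n IH; rewrite ltnS leq_eqVlt => /orP[/eqP <-|mn].
  by rewrite big_nat1 exprS; ring.
by rewrite (big_nat_recr _ _ _ (ltnW mn))/= mulrDl IH// exprS; ring.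
Qed.

(** The convergence criterion behind every series below: domination by a
    geometric series, with the resulting bound on the sum. *)
Lemma geometric_series_cvg u (C q : R) : 0 <= q < 1 ->
  (forall n, rnorm (u n) <= C * q ^+ n) ->
  exists y, series u @ \oo --> y /\ rnorm y <= C / (1 - q).
Proof.
move=> q01 uC.
have C0 : 0 <= C by have := uC 0%N; rewrite expr0 mulr1; apply: le_trans (rnorm_ge0 _).
have sumC m n : rnorm (\sum_(m <= i < n) u i) <= C * q ^+ m / (1 - q).
  rewrite (le_trans (rnorm_sum _ _ _ _))//.
  apply: (@le_trans _ _ (C * \sum_(m <= i < n) q ^+ i)).
    by rewrite mulr_sumr ler_sum.
  by rewrite -mulrA ler_wpM2l// geometric_sum_le.
have cq : (fun n => C * q ^+ n / (1 - q)) @ \oo --> (0 : R).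
  rewrite (_ : (0 : R) = 0 / (1 - q)); last by rewrite mul0r.
  apply: cvgMl; apply: (@cvg_geometric R C q); move/andP: q01 => [q0 q1].
  by rewrite ger0_norm.
have : cvgn (series u).
  apply/cauchy_cvgP/cauchy_seriesP => eps eps0.
  have epsE : eps = (complex.Re eps)%:C%C by rewrite RRe_real// gtr0_real.
  have eps0' : 0 < complex.Re eps by rewrite -ltcR -epsE.
  move/cvgrPdist_lt : cq => /(_ _ eps0')[N _ NP].
  exists ([set n | (N <= n)%N], [set n | (N <= n)%N]) => /=.
    by split; exists N.
  move=> [m n] /= [Nm Nn]; rewrite epsE rnormE ltcR (le_lt_trans (sumC _ _))//.
  by have := NP m Nm; rewrite sub0r normrN; apply: le_lt_trans; rewrite ler_norm.
move=> /cvg_ex[y uy]; exists y; split => //; apply: (rnorm_lim _ _ _ uy).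
near=> n; have := sumC 0%N n; rewrite expr0 mulr1; exact.
Unshelve. all: by end_near. Qed.

End RealNorm.

(** * Vector-valued power series and the identity theorem *)

Section PowerSeries.
Context {R : realType} {H : completeNormedModType R[i]}.
Implicit Types (b : nat -> H) (z : R[i]).
Local Notation normc := Normc.normc.

Definition pser b z : nat -> H := series (fun i => z ^+ i *: b i).

Definition vanishes_near b z0 := exists2 eta : R, 0 < eta &
  forall z, normc (z - z0) < eta -> pser b z @ \oo --> (0 : H).

Lemma pser_cvg b z (C s : R) : 0 <= s -> (forall i, rnorm (b i) <= C * s ^+ i) ->
  normc z * s < 1 ->
  exists y, pser b z @ \oo --> y /\ rnorm y <= C / (1 - normc z * s).
Proof.
move=> s0 bC zs; apply: geometric_series_cvg.
  by rewrite zs mulr_ge0// normc_ge0.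
move=> n; rewrite rnormZ normcX exprMn mulrCA.
by rewrite ler_wpM2l// exprn_ge0// normc_ge0.
Qed.

Lemma pser_recl b z M :
  pser b z M.+1 = b 0%N + z *: pser (fun i => b i.+1) z M.
Proof.
rewrite /pser /series /= big_nat_recl//= expr0 scale1r; congr (_ + _).
by rewrite scaler_sumr; apply: eq_bigr => i _; rewrite scalerA exprS.
Qed.

Lemma pser_recr b z M : pser b z M.+1 = pser b z M + z ^+ M *: b M.
Proof. by rewrite /pser /series /= big_nat_recr. Qed.

Lemma pser_shift_cvg b z (l : H) :
  (fun n => b 0%N + z *: pser (fun i => b i.+1) z n) @ \oo --> l ->
  pser b z @ \oo --> l.
Proof.
move=> h; rewrite -(cvg_shiftS (pser b z)).
rewrite (_ : [sequence _]_n = fun n => b 0%N + z *: pser (fun i => b i.+1) z n)//.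
by apply/funext => n /=; exact: pser_recl.
Qed.

Lemma pser_at0 b : pser b 0 @ \oo --> b 0%N.
Proof.
apply: pser_shift_cvg; under eq_fun do rewrite scale0r addr0.
exact: cvg_cst.
Qed.

(** Division of a power series by [z - z0].  The coefficients of the quotient are
    the tails [b1_m = sum_i b_(m+1+i) z0 ^ i]; they keep the geometric rate [s],
    and only the constant in front of it gets worse. *)
Lemma pser_divide b z0 w (C s : R) : 0 <= s ->
  (forall i, rnorm (b i) <= C * s ^+ i) -> normc z0 * s < 1 ->
  pser b z0 @ \oo --> w ->
  exists2 b1 : nat -> H,
    forall i, rnorm (b1 i) <= C * (s / (1 - normc z0 * s)) * s ^+ i &
    forall z y, normc z * s < 1 -> pser b1 z @ \oo --> y ->
      pser b z @ \oo --> w + (z - z0) *: y.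
Proof.
move=> s0 bC z0s bw.
have /choice[t tP] : forall m, exists y,
    pser (fun i => b (m + i)%N) z0 @ \oo --> y /\
    rnorm y <= C * s ^+ m / (1 - normc z0 * s).
  move=> m; apply: pser_cvg => // i.
  by rewrite -mulrA -exprD.
have t0 : t 0%N = w by apply: cvg_unique bw => //; exact: (tP 0%N).1.
(* This relation makes the product of the quotient with [z - z0] telescope. *)
have tS m : b m = t m - z0 *: t m.+1.
  suff -> : t m = b m + z0 *: t m.+1 by rewrite addrK.
  apply: cvg_unique (tP m).1 _ => //; rewrite -{2}[m]addn0.
  apply: pser_shift_cvg; apply: cvgD; first exact: cvg_cst.
  apply: cvgZr; rewrite (_ : (fun i => _) = fun i => b (m.+1 + i)%N).
    exact: (tP m.+1).1.
  by apply/funext => i; rewrite addSnnS.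
exists (fun m => t m.+1) => [i|z y zs ty].
  apply: le_trans (tP i.+1).2 _.
  by rewrite exprS le_eqVlt; apply/orP; left; apply/eqP; ring.
have partial M : pser b z M =
    w + (z - z0) *: pser (fun m => t m.+1) z M - z ^+ M *: t M.
  elim: M => [|M IH].
    by rewrite /pser /series/= !big_geq// scaler0 addr0 expr0 scale1r t0 subrr.
  rewrite !pser_recr IH tS scalerBr scalerDr.
  have -> : (z - z0) *: (z ^+ M *: t M.+1) =
      z ^+ M.+1 *: t M.+1 - z ^+ M *: (z0 *: t M.+1).
    by rewrite scalerBl !scalerA exprS [z0 * _]mulrC.
  rewrite addrA subrK -!addrA; congr (_ + (_ + _)).
  by rewrite addrCA subrr addr0.
rewrite (funext partial).
rewrite -[w + _]subr0; apply: cvgB.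
  by apply: cvgD; [exact: cvg_cst|exact: cvgZr].
pose v n := C / (1 - normc z0 * s) * (normc z * s) ^+ n.
apply: (@cvg_rnorm0 _ _ _ v) => [n|].
  rewrite rnormZ normcX /v exprMn mulrCA ler_wpM2l ?exprn_ge0 ?normc_ge0//.
  by rewrite mulrAC; exact: (tP n).2.
by apply: cvg_geometric; rewrite ger0_norm ?mulr_ge0 ?normc_ge0.
Qed.

(** Continuity at [z0]: dividing by [z - z0] shows that the sum at [z0] has norm
    at most a constant times [|z - z0|]. *)
Lemma vanishes_at_center b z0 (C s eta : R) : 0 <= s ->
  (forall i, rnorm (b i) <= C * s ^+ i) -> normc z0 * s < 1 -> 0 < eta ->
  (forall z, z != z0 -> normc (z - z0) < eta -> pser b z @ \oo --> (0 : H)) ->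
  pser b z0 @ \oo --> (0 : H).
Proof.
move=> s0 bC z0s eta0 van.
have [w [bw _]] := pser_cvg _ _ _ _ s0 bC z0s.
suff w0 : w = 0 by rewrite -[X in _ --> X]w0.
have [b1 b1C b1P] := pser_divide _ _ _ _ _ s0 bC z0s bw.
apply/eqP; rewrite -rnorm_eq0 eq_le rnorm_ge0 andbT.
set g := 1 - normc z0 * s in b1C.
have g0 : 0 < g by rewrite subr_gt0.
set C1 := C * _ in b1C.
have C10 : 0 <= C1.
  by have := b1C 0%N; rewrite expr0 mulr1; apply: le_trans (rnorm_ge0 _).
apply/ler_addgt0Pr => eps eps0; rewrite add0r.
(* [d] is below [eta], keeps [|z| s <= 1 - g / 2], so that the quotient is
   bounded by [C1 / (g / 2)], and makes [d C1 / (g / 2) <= eps]. *)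
pose d := Num.min (eta / 2) (Num.min (g / (2 * (s + 1))) (eps * (g / 2) / (C1 + 1))).
have d0 : 0 < d.
  rewrite !lt_min !divr_gt0 ?mulr_gt0 ?divr_gt0//; lra.
pose z := z0 + d%:C%C.
have zz0 : normc (z - z0) = d by rewrite /z addrAC subrr add0r normc_real gtr0_norm.
have ds : d * s <= g / 2.
  have : d <= g / (2 * (s + 1)) by rewrite /d !ge_min lexx !orbT.
  rewrite ler_pdivlMr; last lra.
  move=> h; rewrite ler_pdivlMr//; apply: le_trans h; nra.
have zg : normc z * s <= 1 - g / 2.
  have : normc z <= normc z0 + d.
    by rewrite (le_trans (le_normcD _ _))// normc_real gtr0_norm.
  by rewrite /g in ds *; nra.
have zs : normc z * s < 1 by lra.
have [y [b1y yC]] := pser_cvg _ _ _ _ s0 b1C zs.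
have h : w = - ((z - z0) *: y).
  apply/eqP; rewrite -addr_eq0; apply/eqP.
  apply: (cvg_unique _ (b1P _ _ zs b1y)) => //.
  apply: van; last by rewrite zz0 /d !gt_min; apply/orP; left; lra.
  by rewrite -subr_eq0 -normc_eq0 zz0 gt_eqF.
rewrite h rnormN rnormZ zz0.
have yC' : rnorm y <= C1 / (g / 2).
  apply: le_trans yC _; rewrite ler_wpM2l// lef_pV2 ?posrE; lra.
have dC : d * (C1 + 1) <= eps * (g / 2).
  by rewrite -ler_pdivlMr; [rewrite /d !ge_min lexx !orbT|lra].
apply: le_trans (ler_wpM2l (ltW d0) yC') _.
rewrite mulrA ler_pdivrMr; last lra.
apply: le_trans dC; rewrite ler_wpM2l//; lra.
Qed.

(** A zero of infinite order spreads: the series is divisible by [(z - z0) ^ N]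
    for every [N], with a quotient of size at most a constant times [K ^ N], where
    [K = s / (1 - |z0| s)]; hence its sum is [0] as soon as [|z - z0| K < 1]. *)
Lemma vanishes_ball b z0 (C s : R) : 0 <= s ->
  (forall i, rnorm (b i) <= C * s ^+ i) -> normc z0 * s < 1 ->
  vanishes_near b z0 ->
  forall z, normc (z - z0) * s < 1 - normc z0 * s -> pser b z @ \oo --> (0 : H).
Proof.
move=> s0 bC z0s [eta eta0 van] z zz0.
have zs : normc z * s < 1.
  have : normc z <= normc (z - z0) + normc z0.
    by rewrite -{1}[z](subrK z0) le_normcD.
  by nra.
pose K := s / (1 - normc z0 * s).
have g0 : 0 < 1 - normc z0 * s by rewrite subr_gt0.
have step N : exists2 bN : nat -> H,
    forall i, rnorm (bN i) <= C * K ^+ N * s ^+ i &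
    forall z y, normc z * s < 1 -> pser bN z @ \oo --> y ->
      pser b z @ \oo --> (z - z0) ^+ N *: y.
  elim: N => [|N [bN bNC bNP]].
    exists b => [i|z' y _]; first by rewrite expr0 mulr1.
    by rewrite expr0 scale1r.
  have bN0 : pser bN z0 @ \oo --> (0 : H).
    pose eta' := Num.min eta ((1 - normc z0 * s) / (s + 1)).
    have eta'0 : 0 < eta' by rewrite lt_min eta0 divr_gt0//; lra.
    apply: (vanishes_at_center _ _ _ _ eta' s0 bNC z0s eta'0) => z' z'z0.
    rewrite lt_min => /andP[z'eta]; rewrite ltr_pdivlMr; last lra.
    move=> z's.
    have z's' : normc z' * s < 1.
      have : normc z' <= normc (z' - z0) + normc z0.
        by rewrite -{1}[z'](subrK z0) le_normcD.
      by have := normc_ge0 (z' - z0); nra.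
    have [y [bNy _]] := pser_cvg _ _ _ _ s0 bNC z's'.
    have : (z' - z0) ^+ N *: y = 0.
      by apply: (cvg_unique _ (bNP _ _ z's' bNy)) => //; exact: van.
    move/eqP; rewrite scaler_eq0 expf_eq0 subr_eq0 (negbTE z'z0) andbF/=.
    by move=> /eqP y0; rewrite -y0.
  have [b1 b1C b1P] := pser_divide _ _ _ _ _ s0 bNC z0s bN0.
  exists b1 => [i|z' y z's b1y].
    by apply: le_trans (b1C i) _; rewrite exprSr !mulrA.
  have := bNP _ _ z's (b1P _ _ z's b1y).
  by rewrite add0r scalerA -exprSr.
have [y [by_ _]] := pser_cvg _ _ _ _ s0 bC zs.
suff y0 : y = 0 by rewrite -y0.
apply/eqP; rewrite -rnorm_eq0 eq_le rnorm_ge0 andbT.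
have yN N : rnorm y <= C / (1 - normc z * s) * (normc (z - z0) * K) ^+ N.
  have [bN bNC bNP] := step N.
  have [yN [bNy yNC]] := pser_cvg _ _ _ _ s0 bNC zs.
  have -> : y = (z - z0) ^+ N *: yN.
    by apply: (cvg_unique _ by_ (bNP _ _ zs bNy)).
  rewrite rnormZ normcX exprMn mulrCA ler_wpM2l ?exprn_ge0 ?normc_ge0//.
  by rewrite mulrAC.
have KN : (fun N => C / (1 - normc z * s) * (normc (z - z0) * K) ^+ N)
    @ \oo --> (0 : R).
  have K0 : 0 <= normc (z - z0) * K.
    by rewrite mulr_ge0 ?normc_ge0// divr_ge0// ltW.
  apply: cvg_geometric; rewrite (ger0_norm K0).
  by rewrite mulrA ltr_pdivrMr// mul1r.
rewrite -(cvg_lim _ KN)//.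
by apply: limr_ge; [exact: (cvgP _ KN)|near=> N; exact: yN].
Unshelve. all: by end_near. Qed.

(** At the origin, [b 0] is the value at [0], and division by [z] shifts the
    coefficients. *)
Lemma vanishes_near0_coef b (C s : R) : 0 <= s ->
  (forall i, rnorm (b i) <= C * s ^+ i) ->
  vanishes_near b 0 -> forall i, b i = 0.
Proof.
move=> s0 bC [eta eta0 van] i.
have value0 b' : (forall z, normc (z - 0) < eta -> pser b' z @ \oo --> (0 : H)) ->
    b' 0%N = 0.
  move=> /(_ 0); rewrite subr0 Normc.normc0 => /(_ eta0) b'0.
  by apply: (cvg_unique _ _ b'0) => //; exact: pser_at0.
elim: i b C bC van => [|i IH] b C bC van; first exact: value0.
have b0 := value0 _ van.
have bC' j : rnorm (b j.+1) <= C * s * s ^+ j by rewrite -mulrA -exprS.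
have punct z : z != 0 -> normc (z - 0) < eta -> pser (fun i => b i.+1) z @ \oo --> (0 : H).
  move=> z0 zeta; rewrite -(scaler0 _ z^-1).
  rewrite (_ : pser _ z = fun n => z^-1 *: pser b z n.+1).
    by apply: cvgZr; rewrite (cvg_shiftS (pser b z)); exact: van.
  by apply/funext => n; rewrite pser_recl b0 add0r scalerK.
apply: (IH (fun i => b i.+1) _ bC') => z zeta.
have [->|z0] := eqVneq z 0; last exact: punct.
by apply: (vanishes_at_center _ _ _ _ eta s0 bC') => //; rewrite Normc.normc0 mul0r.
Qed.

(** Identity theorem.  The ball of [vanishes_ball] need not contain the origin,
    so the centre is moved towards it along the points [(1 - th) ^ n z0]; each of
    them lies in the ball around the previous one, and the last ball used
    contains a neighbourhood of [0]. *)
Theorem identity_theorem b z0 (C s : R) : 0 < s ->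
  (forall i, rnorm (b i) <= C * s ^+ i) -> normc z0 * s < 1 ->
  vanishes_near b z0 -> forall i, b i = 0.
Proof.
move=> s0 bC z0s van.
pose th := (1 - normc z0 * s) / 2.
have z0s0 : 0 <= normc z0 * s by rewrite mulr_ge0 ?normc_ge0 ?ltW.
have th01 : 0 <= 1 - th < 1 by rewrite /th; lra.
pose zz n := (1 - th)%:C%C ^+ n * z0.
have zzE n : normc (zz n) * s = (1 - th) ^+ n * (normc z0 * s).
  by rewrite Normc.normcM normcX normc_real ger0_norm ?mulrA//; case/andP: th01.
have zzs n : normc (zz n) * s <= normc z0 * s.
  by rewrite zzE ler_piMl// exprn_ile1//; lra.
have vann n : vanishes_near b (zz n).
  elim: n => [|n IH]; first by rewrite /zz expr0 mul1r.
  have zn1 : normc (zz n) * s < 1 by have := zzs n; lra.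
  exists (th / s); first by rewrite divr_gt0// /th; lra.
  move=> z; rewrite ltr_pdivlMr// => zzn.
  apply: (vanishes_ball _ _ _ _ (ltW s0) bC zn1 IH).
  have : normc (z - zz n) <= normc (z - zz n.+1) + normc (zz n.+1 - zz n).
    by rewrite (le_trans _ (le_normcD _ _))// addrA subrK.
  have -> : normc (zz n.+1 - zz n) = th * normc (zz n).
    have -> : zz n.+1 - zz n = - (th%:C%C * zz n).
      by rewrite /zz exprS rmorphB rmorph1; ring.
    by rewrite normcN Normc.normcM normc_real ger0_norm// /th; lra.
  move=> h; have := zzs n; have := normc_ge0 (zz n); rewrite /th in zzn h *.
  nra.
have := @cvg_geometric R (normc z0 * s) (1 - th).
rewrite ger0_norm; last by case/andP: th01.
case/andP: th01 => _ th1 /(_ th1)/cvgrPdist_lt/(_ (2^-1)).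
rewrite invr_gt0 ltr0n => /(_ isT)[N _ /(_ N (leqnn N))].
rewrite /geometric/= sub0r normrN mulrC -zzE ger0_norm; last by rewrite mulr_ge0 ?normc_ge0 ?ltW.
move=> zN; apply: (vanishes_near0_coef _ _ _ (ltW s0) bC).
exists ((2^-1 - normc (zz N) * s) / s); first by rewrite divr_gt0// subr_gt0.
move=> z; rewrite subr0 ltr_pdivlMr// => zs.
have zN1 : normc (zz N) * s < 1 by lra.
apply: (vanishes_ball _ _ _ _ (ltW s0) bC zN1 (vann N)).
have := normcB z (zz N); nra.
Qed.

End PowerSeries.

(** * Root tests from upper and lower limits *)

Section RootTest.
Context {R : realType}.
Implicit Types (u : nat -> \bar R) (a : \bar R).
Local Open Scope ereal_scope.

(** This and the next three lemmas turn a strict inequality for an upper or lower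
    limit into a statement about all large, or infinitely many, indices. *)
Lemma limn_esup_lt u a : limn_esup u < a -> \forall n \near \oo, u n < a.
Proof.
rewrite /limn_esup limf_esupE => /ereal_inf_lt[_ [V FV <-] Va].
apply: filterS FV => n Vn; apply: le_lt_trans Va.
by apply: ereal_sup_ubound; exists n.
Qed.

Lemma lt_limn_esup u a : a < limn_esup u ->
  forall N, exists2 n, (N <= n)%N & a < u n.
Proof.
move=> au N; apply: contrapT => nex; move: au; apply/negP; rewrite -leNgt.
rewrite /limn_esup limf_esupE.
apply: (@le_trans _ _ (ereal_sup (u @` [set n | (N <= n)%N]))).
  by apply: ereal_inf_lbound; exists [set n | (N <= n)%N] => //; exists N.
apply: ge_ereal_sup => _ [n /= Nn <-]; rewrite leNgt; apply/negP => aun.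
by apply: nex; exists n.
Qed.

Lemma lt_limn_einf u a : a < limn_einf u -> \forall n \near \oo, a < u n.
Proof.
rewrite /limn_einf lteNr => /limn_esup_lt; apply: filterS => n.
by rewrite lteNl oppeK.
Qed.

Lemma limn_einf_lt u a : limn_einf u < a ->
  forall N, exists2 n, (N <= n)%N & u n < a.
Proof.
rewrite /limn_einf lteNl => /lt_limn_esup h N; have [n Nn] := h N.
by rewrite lteNl oppeK; exists n.
Qed.

Local Open Scope ring_scope.

(** With [root_lt] and [lt_root], converts bounds on [n]-th roots into geometric
    bounds. *)
Lemma root_powK (x : R) n : 0 <= x -> (0 < n)%N -> (x `^ n%:R^-1) ^+ n = x.
Proof.
move=> x0 n0; rewrite -powR_mulrn ?powR_ge0// -powRrM mulVf ?powRr1//.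
by rewrite pnatr_eq0 -lt0n.
Qed.

Lemma root_lt (x r : R) n : 0 <= x -> 0 <= r -> (0 < n)%N ->
  (x `^ n%:R^-1 < r) = (x < r ^+ n).
Proof.
by move=> x0 r0 n0; rewrite -{2}(root_powK _ _ x0 n0) ltr_pXn2r// nnegrE// powR_ge0.
Qed.

Lemma lt_root (x r : R) n : 0 <= x -> 0 <= r -> (0 < n)%N ->
  (r < x `^ n%:R^-1) = (r ^+ n < x).
Proof.
by move=> x0 r0 n0; rewrite -{2}(root_powK _ _ x0 n0) ltr_pXn2r// nnegrE// powR_ge0.
Qed.

(** The finitely many exceptional terms are absorbed by the constant. *)
Lemma geometric_bound_near (v : nat -> R) (C q : R) : 0 < q ->
  (\forall n \near \oo, v n <= C * q ^+ n) ->
  exists C', forall n, v n <= C' * q ^+ n.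
Proof.
move=> q0 [N _ vC].
exists (`|C| + \sum_(i < N) `|v i| / q ^+ i) => n.
have qn : 0 < q ^+ n by rewrite exprn_gt0.
rewrite mulrDl; have [Nn|nN] := leqP N n.
  apply: le_trans (vC n Nn) _; rewrite -[leLHS]addr0 lerD//.
    by rewrite ler_wpM2r ?ler_norm// ltW.
  by rewrite mulr_ge0 ?(ltW qn)// sumr_ge0// => i _; rewrite divr_ge0// exprn_ge0// ltW.
rewrite (bigD1 (Ordinal nN))//= mulrDl divfK ?gt_eqF//.
rewrite addrCA (le_trans (ler_norm _))// lerDl addr_ge0 ?mulr_ge0 ?(ltW qn)//.
by rewrite sumr_ge0// => i _; rewrite divr_ge0// exprn_ge0// ltW.
Qed.

End RootTest.

(** * Coordinates in an orthonormal basis *)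

Section Coordinates.
Context {R : realType} {H : completeNormedModType R[i]}.
Context (dot : {dot H for Num.conj}) (e : int -> H).
Hypothesis dotP : inner_product dot.
Hypothesis eP : orthonormal_basis dot e.
Local Notation normc := Normc.normc.
Implicit Types (x y v : H) (n : int).

(** A bounded functional that vanishes on a set vanishes on its closed span: the
    principle that reduces statements about vectors to basis vectors. *)
Lemma closed_span_vanish (A : set H) (phi : H -> R[i]) (M : R) : 0 <= M ->
  {morph phi : y v / y + v} -> (forall a y, phi (a *: y) = a * phi y) ->
  (forall y, normc (phi y) <= M * rnorm y) ->
  (forall v, A v -> phi v = 0) -> forall x, closed_span A x -> phi x = 0.
Proof.
move=> M0 phiD phiZ phiM phiA x Ax.
have phi0 : phi 0 = 0 by rewrite -(scale0r 0) phiZ mul0r.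
apply/eqP; rewrite -normc_eq0 eq_le normc_ge0 andbT.
apply/ler_addgt0Pr => eps eps0; rewrite add0r.
have M1 : 0 < M + 1 by rewrite ltr_wpDl.
have d0 : 0 < eps / (M + 1) by rewrite divr_gt0.
have /Ax[_ [[n [c [v [vA ->]]]] /= xa]] : nbhs x [set a | rnorm (x - a) < eps / (M + 1)].
  apply/nbhs_normP; exists (eps / (M + 1))%:C%C => /=; first by rewrite ltcR.
  by move=> a /=; rewrite rnormE ltcR.
have phia : phi (\sum_(i < n) c i *: v i) = 0.
  apply: (big_ind (fun z => phi z = 0)) => // [y z y0 z0|i _].
    by rewrite phiD y0 z0 addr0.
  by rewrite phiZ phiA ?mulr0.
have -> : phi x = phi (x - \sum_(i < n) c i *: v i).
  by have := phiD (x - \sum_(i < n) c i *: v i) (\sum_(i < n) c i *: v i);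
    rewrite subrK phia addr0.
apply: le_trans (phiM _) _; move: xa; rewrite ltr_pdivlMr// => xa.
have := rnorm_ge0 (x - \sum_(i < n) c i *: v i); nra.
Qed.

Lemma dotC x y : dot x y = (dot y x)^*.
Proof. by rewrite hermC expr0 mul1r. Qed.

Lemma dotee n : dot (e n) (e n) = 1.
Proof. by rewrite eP.1 eqxx. Qed.

Lemma rnorm_e n : rnorm (e n) = 1.
Proof.
have := dotP (e n); rewrite dotee rnormE -rmorphXn/= => /esym/(congr1 (@complex.Re R))/= h.
by have := rnorm_ge0 (e n); nra.
Qed.

(** The Cauchy-Schwarz inequality against a basis vector: the
    squares of the two sides differ by the squared norm of the component of [y]
    orthogonal to [e n]. *)
Lemma normc_dot_le y n : normc (dot y (e n)) <= rnorm y.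
Proof.
set a := dot y (e n); pose z := y - a *: e n.
have ze : dot z (e n) = 0 by rewrite /z linearBl/= linearZl_LR/= dotee mulr1 subrr.
have : 0 <= dot z z by rewrite dotP exprn_ge0.
rewrite {2}/z linearBr/= linearZr_LR/= ze mulr0 subr0 /z linearBl/= linearZl_LR/=.
rewrite [dot (e n) y]dotC -/a -normCK dotP subr_ge0 rnormE normc_normE -!rmorphXn/= lecR.
by rewrite ler_pXn2r ?nnegrE ?normc_ge0 ?rnorm_ge0.
Qed.

Lemma coord_supp (P : int -> Prop) x n : closed_span [set e m | m in P] x ->
  ~ P n -> dot x (e n) = 0.
Proof.
move=> Px nP; apply: (closed_span_vanish _ (fun y => dot y (e n)) 1 _ _ _ _ _ _ Px) => //.
- by move=> y v; rewrite linearDl.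
- by move=> a y; rewrite linearZl_LR.
- by move=> y; rewrite mul1r normc_dot_le.
by move=> _ [m Pm <-]; rewrite eP.1; case: eqP Pm => // ->.
Qed.

(** Completeness of the basis.  If [x] is orthogonal to all [e n], it is
    orthogonal to every finite combination [a], so the norm of [x] is at most that
    of [x - a] by Pythagoras, and [a] can be chosen close to [x]. *)
Lemma coord_eq0 x : (forall n, dot x (e n) = 0) -> x = 0.
Proof.
move=> x0; apply/eqP; rewrite -rnorm_eq0 eq_le rnorm_ge0 andbT.
apply/ler_addgt0Pr => eps eps0; rewrite add0r.
have : closed_span (range e) x by rewrite eP.2.
have /[swap]/[apply] : nbhs x [set a | rnorm (x - a) < eps].
  apply/nbhs_normP; exists eps%:C%C => /=; first by rewrite ltcR.
  by move=> a /=; rewrite rnormE ltcR.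
move=> [_ [[n [c [v [vA ->]]]] /= xa]]; apply: le_trans (ltW xa).
set a := \sum_(i < n) _.
have xa0 : dot x a = 0.
  rewrite linear_sumr big1// => i _; rewrite linearZr_LR/=.
  by have [m _ <-] := vA i; rewrite x0 mulr0.
have ax0 : dot a x = 0 by rewrite dotC xa0 rmorph0.
have : dot (x - a) (x - a) = dot x x + dot a a.
  by rewrite linearBr/= !linearBl/= xa0 ax0 subr0 sub0r opprK.
rewrite !dotP !rnormE -!rmorphXn -rmorphD/= => /(@complexI R) h.
rewrite -(@ler_pXn2r _ 2) ?nnegrE ?rnorm_ge0// h lerDl.
by rewrite exprn_ge0 ?rnorm_ge0.
Qed.

Lemma coord_inj x y : (forall n, dot x (e n) = dot y (e n)) -> x = y.
Proof.
move=> xy; apply/eqP; rewrite -subr_eq0; apply/eqP/coord_eq0 => n.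
by rewrite linearBl/= xy subrr.
Qed.

Lemma coord_lim (u : nat -> H) y n c : u @ \oo --> y ->
  (\forall k \near \oo, dot (u k) (e n) = c) -> dot y (e n) = c.
Proof.
move=> /cvg_rnormP uy uc; apply/eqP; rewrite -subr_eq0 -normc_eq0 eq_le normc_ge0 andbT.
apply/ler_addgt0Pr => eps eps0; rewrite add0r.
near \oo => k.
have <- : dot (u k) (e n) = c by near: k.
rewrite -linearBl/= (le_trans (normc_dot_le _ _))// ltW//; near: k; exact: uy.
Unshelve. all: by end_near. Qed.

(** Both sides are bounded functionals of [y] and agree on basis vectors. *)
Lemma coord_shift (w : int -> R) (S : {linear H -> H}) :
  bilateral_weighted_shift e w S ->
  forall y n, dot (S y) (e n) = (w (n - 1))%:C%C * dot y (e (n - 1)).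
Proof.
move=> [Sc Se] y n.
have [M [M0 SM]] : exists M : R, 0 < M /\ forall y, rnorm (S y) <= M * rnorm y.
  have /linear_bounded_continuous/linear_boundedP : continuous S by [].
  move=> [M0 [M0real h]].
  pose M : R := Num.max (complex.Re M0) 0 + 1.
  have ? : 0 < M by rewrite /M ltr_wpDl// le_max lexx orbT.
  exists M; split=> // z; rewrite -lecR rmorphM/= -!rnormE; apply: h.
  rewrite -(RRe_real M0real) ltcR /M ltr_pwDr// le_max lexx//.
pose phi z := dot (S z) (e n) - (w (n - 1))%:C%C * dot z (e (n - 1)).
suff : phi y = 0 by move/eqP; rewrite subr_eq0 => /eqP.
apply: (@closed_span_vanish (range e) phi (M + `|w (n - 1)|)).
- by rewrite addr_ge0// ltW.
- move=> z v; rewrite /phi linearD/= !linearDl/= mulrDr; ring.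
- move=> a z; rewrite /phi linearZ/= !linearZl_LR/=; ring.
- move=> z; rewrite (le_trans (normcB _ _))// mulrDl lerD//.
    by rewrite (le_trans (normc_dot_le _ _)).
  by rewrite Normc.normcM normc_real ler_wpM2l// normc_dot_le.
- move=> _ [m _ <-]; rewrite /phi Se linearZl_LR/= !eP.1.
  have -> : (m + 1 == n) = (m == n - 1) by rewrite -subr_eq opprK.
  by case: eqP => [->|_]; rewrite ?mulr1 ?mulr0 subrr.
by rewrite eP.2.
Qed.

End Coordinates.

(** * The eigenvalue equation of a shift in normalized coordinates *)

Section Shift.
Context {R : realType} {H : completeNormedModType R[i]}.
Context (dot : {dot H for Num.conj}) (e : int -> H).
Context (w : int -> R) (S : {linear H -> H}).
Hypothesis dotP : inner_product dot.
Hypothesis eP : orthonormal_basis dot e.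
Hypothesis w0 : forall n : int, 0 < w n.
Hypothesis Se : bilateral_weighted_shift e w S.
Local Notation normc := Normc.normc.
Implicit Types (x y v : H) (n : int) (l : R[i]).

Lemma wbeta_gt0 n : 0 < wbeta w n.
Proof.
by case: n => m /=; rewrite ?invr_gt0; apply: prodr_gt0 => j _; exact: w0.
Qed.

Lemma wbetaS n : wbeta w (n + 1) = w n * wbeta w n.
Proof.
case: n => [m|[|m]].
- rewrite -PoszD addn1 /= big_ord_recr /= mulrC//.
- by rewrite /= big_ord0 big_ord1 mulfV// gt_eqF.
have -> : Negz m.+1 + 1 = Negz m by lia.
rewrite /= [in RHS]big_ord_recr/= invfM mulrCA NegzE mulfV ?mulr1// gt_eqF//.
Qed.

(** Dividing by [wbeta w n] turns the weighted shift into an unweighted one. *)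
Definition ncoord x n : R[i] := dot x (e n) / (wbeta w n)%:C%C.

Lemma ncoordK x n : dot x (e n) = ncoord x n * (wbeta w n)%:C%C.
Proof.
by rewrite divfK// (fmorph_eq0 (real_complex R)) gt_eqF// wbeta_gt0.
Qed.

Lemma ncoord_le x n : normc (ncoord x n) * wbeta w n <= rnorm x.
Proof.
have -> : normc (ncoord x n) * wbeta w n = normc (dot x (e n)).
  by rewrite [in RHS]ncoordK [RHS]Normc.normcM normc_real gtr0_norm// wbeta_gt0.
exact: normc_dot_le.
Qed.

Lemma ncoord_inj x y : (forall n, ncoord x n = ncoord y n) -> x = y.
Proof.
by move=> xy; apply: (coord_inj _ _ dotP eP) => n; rewrite !ncoordK xy.
Qed.

Lemma ncoord_shift l y n :
  ncoord (S y - l *: y) n = ncoord y (n - 1) - l * ncoord y n.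
Proof.
rewrite /ncoord linearBl/= linearZl_LR/= (coord_shift _ _ dotP eP _ _ Se).
have := wbetaS (n - 1); rewrite subrK => ->; rewrite rmorphM/=.
have h1 : (w (n - 1))%:C%C != 0 by rewrite (fmorph_eq0 (real_complex R)) gt_eqF.
have h2 : (wbeta w (n - 1))%:C%C != 0.
  by rewrite (fmorph_eq0 (real_complex R)) gt_eqF// wbeta_gt0.
by field; rewrite h1 h2.
Qed.

Section LeftGrowth.
Hypothesis r2 : r2_minus w = 0%E.

(** The form in which [r2_minus w = 0] is used: [beta_(-n)] is infinitely often
    larger than any prescribed geometric sequence. *)
Lemma wbeta_left_growth (eps : R) : 0 < eps ->
  forall N, exists2 n : nat, (N <= n)%N & 1 < eps ^+ n * wbeta w (- n%:Z).
Proof.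
move=> eps0 N.
have : (r2_minus w < eps%:E)%E by rewrite r2 lte_fin.
move=> /limn_einf_lt /(_ N.+1)[n Nn]; rewrite lte_fin root_lt ?(leq_ltn_trans _ Nn)//; last first.
- exact: ltW.
- by rewrite divr_ge0// ltW// wbeta_gt0.
rewrite ltr_pdivrMr ?wbeta_gt0// => h.
by exists n => //; exact: ltnW.
Qed.

(** To the left of the support of [x] the recursion is [Y_(k-1) = l Y_k], so a
    non-zero [Y_k] would make the coordinates [beta_(k-j) l ^ j Y_k] of [y]
    unbounded. *)
Lemma ncoord_left0 l x y n : l != 0 -> S y - l *: y = x ->
  (forall k, k < n -> ncoord x k = 0) -> forall k, k < n -> ncoord y k = 0.
Proof.
move=> l0 yx x0 k kn.
have back (j : nat) : ncoord y (k - j%:Z) = l ^+ j * ncoord y k.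
  elim: j => [|j IH]; first by rewrite expr0 mul1r subr0.
  have : ncoord x (k - j%:Z) = 0 by apply: x0; lia.
  rewrite -yx ncoord_shift => /eqP; rewrite subr_eq0 => /eqP h.
  by rewrite exprS -mulrA -IH -h; congr ncoord; lia.
(* Moving [k] to a non-positive index keeps the exponents below natural. *)
suff : ncoord y (k - `|k|%N%:Z) == 0.
  by rewrite back mulf_eq0 expf_eq0 (negbTE l0) andbF => /eqP.
have [q qE] : exists q : nat, k - `|k|%N%:Z = - q%:Z.
  by exists (absz (`|k|%N%:Z - k)); lia.
rewrite qE -normc_eq0 eq_le normc_ge0 andbT.
set a := normc _.
have nl0 : 0 < normc l by rewrite lt_neqAle eq_sym normc_eq0 l0 normc_ge0.
pose D := rnorm y * normc l ^+ q.
have aD : forall N, exists2 n : nat, (N <= n)%N & 2 ^+ n * a <= D.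
  move=> N.
  (* The rate [|l| / 2] leaves a factor [2 ^ m] after comparison with [|l| ^ m]. *)
  have [m Nm hm] := @wbeta_left_growth (normc l / 2) (divr_gt0 nl0 (ltr0Sn _ 1)) (maxn N q).
  have [Nm' qm] : (N <= m)%N /\ (q <= m)%N by apply/andP; rewrite -geq_max.
  exists m => //.
  have ym : ncoord y (- m%:Z) = l ^+ (m - q) * ncoord y (- q%:Z).
    rewrite -qE !back mulrA -exprD -back; congr ncoord; lia.
  have := ncoord_le y (- m%:Z); rewrite ym Normc.normcM normcX -/a => h.
  have h2 : normc l ^+ m * a * wbeta w (- m%:Z) <= D.
    rewrite -(subnK qm) exprD /D.
    rewrite [X in X <= _](_ : _ = normc l ^+ (m - q) * a * wbeta w (- m%:Z) * normc l ^+ q).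
      by rewrite ler_wpM2r ?exprn_ge0 ?normc_ge0.
    by rewrite subnK//; ring.
  apply: le_trans h2.
  have -> : normc l ^+ m = 2 ^+ m * (normc l / 2) ^+ m.
    by rewrite -exprMn mulrC divfK// pnatr_eq0.
  rewrite [leRHS](_ : _ = 2 ^+ m * a * ((normc l / 2) ^+ m * wbeta w (- m%:Z))); last by ring.
  by rewrite ler_peMr ?mulr_ge0 ?exprn_ge0 ?normc_ge0// ltW.
rewrite leNgt; apply/negP => a0.
have [m Nm] := aD (Num.trunc (D / a)).+1.
apply/negP; rewrite -ltNge -ltr_pdivrMr//.
apply: lt_le_trans (truncnS_gt _) _.
apply: (@le_trans _ _ m%:R); first by rewrite ler_nat.
by rewrite -natrX ler_nat ltnW// ltn_expl.
Qed.

Lemma solution_unique l x y y' : l != 0 ->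
  S y - l *: y = x -> S y' - l *: y' = x -> y = y'.
Proof.
move=> l0 yx y'x; apply: ncoord_inj => n.
apply/eqP; rewrite -subr_eq0; apply/eqP.
have -> : ncoord y n - ncoord y' n = ncoord (y - y') n.
  by rewrite /ncoord linearBl/= mulrBl.
apply: (@ncoord_left0 l 0 (y - y') (n + 1) l0); last by rewrite ltrDl.
  by rewrite linearB/= scalerBr opprD opprK addrACA yx -[l *: y']opprK -opprD y'x subrr.
by move=> k _; rewrite /ncoord linear0l mul0r.
Qed.

End LeftGrowth.

Section Supported.
(** For vectors without coordinates below [- K], the coordinate at [i - K] is
    indexed by the natural number [i]. *)
Variable K : nat.
Local Notation ix i := (i%:Z - K%:Z).
Local Notation supported x := (forall n, n < - K%:Z -> dot x (e n) = 0).

Lemma supported_ncoord x : supported x -> forall n, n < - K%:Z -> ncoord x n = 0.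
Proof. by move=> xK n /xK; rewrite /ncoord => ->; rewrite mul0r. Qed.

Lemma supported_eq0 x : supported x -> (forall i : nat, ncoord x (ix i) = 0) -> x = 0.
Proof.
move=> xK x0; apply: (coord_eq0 _ _ dotP eP) => n.
have [/xK//|nK] := ltP n (- K%:Z).
have := x0 (absz (n + K%:Z)); rewrite (_ : ix _ = n); last by lia.
by rewrite ncoordK => ->; rewrite mul0r.
Qed.

(** * Necessary conditions for local solvability *)

Section Necessary.
Hypothesis r2 : r2_minus w = 0%E.

Lemma ncoord_solution l x y (i : nat) : supported x -> l != 0 -> S y - l *: y = x ->
  l ^+ i.+1 * ncoord y (ix i) = - \sum_(j < i.+1) l ^+ j * ncoord x (ix j).
Proof.
move=> xK l0 yx; elim: i => [|i IH].
  have y0 : ncoord y (ix 0%N - 1) = 0.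
    apply: (ncoord_left0 r2 _ _ _ (- K%:Z) l0 yx); last by lia.
    exact: supported_ncoord.
  have x0 : ncoord x (ix 0%N) = - (l * ncoord y (ix 0%N)).
    by rewrite -{1}yx ncoord_shift y0 sub0r.
  by rewrite big_ord1 expr1 expr0 mul1r x0 opprK.
rewrite big_ord_recr/= opprD -IH -yx ncoord_shift.
rewrite (_ : ix i.+1 - 1 = ix i); last by lia.
by rewrite exprS; ring.
Qed.

(** The scalar coefficients are placed on the line of [e 0], which makes the
    power-series results for Banach-space-valued series applicable. *)
Definition xcoef x (i : nat) : H := ncoord x (ix i) *: e 0.

Lemma rnorm_xcoef x i : rnorm (xcoef x i) = normc (ncoord x (ix i)).
Proof. by rewrite rnormZ (rnorm_e _ _ dotP eP) mulr1. Qed.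

(** By [ncoord_solution] the partial sum is [- l ^ (i+1)] times a normalized
    coordinate of [y]. *)
Lemma pser_xcoef_le l x y i : supported x -> l != 0 -> S y - l *: y = x ->
  rnorm (pser (xcoef x) l i.+1) * wbeta w (ix i) <= normc l ^+ i.+1 * rnorm y.
Proof.
move=> xK l0 yx.
have -> : pser (xcoef x) l i.+1 = (- (l ^+ i.+1 * ncoord y (ix i))) *: e 0.
  rewrite (ncoord_solution _ _ _ _ xK l0 yx) opprK scaler_suml /pser /series/=.
  by rewrite big_mkord; apply: eq_bigr => j _; rewrite scalerA.
rewrite rnormZ (rnorm_e _ _ dotP eP) mulr1 normcN Normc.normcM normcX -mulrA.
by rewrite ler_wpM2l ?exprn_ge0 ?normc_ge0// ncoord_le.
Qed.

(** The partial sums converge, and infinitely many of them are bounded by a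
    constant times [(|l| / rho) ^ n]. *)
Lemma pser_xcoef_vanish l x y (C rho : R) : supported x -> l != 0 ->
  S y - l *: y = x -> normc l < rho ->
  (forall i : nat, normc (ncoord x (ix i)) <= C * rho^-1 ^+ i) ->
  (forall N, exists2 n : nat, (N <= n)%N & rho ^+ n < wbeta w n%:Z) ->
  pser (xcoef x) l @ \oo --> (0 : H).
Proof.
move=> xK l0 yx lrho xC growth.
have nl0 : 0 <= normc l := normc_ge0 l.
have rho0 : 0 < rho by apply: le_lt_trans lrho.
have q01 : `|normc l / rho| < 1 by rewrite ger0_norm ?divr_ge0 ?(ltW rho0)// ltr_pdivrMr// mul1r.
have [F [xF _]] : exists F, pser (xcoef x) l @ \oo --> F /\
    rnorm F <= C / (1 - normc l * rho^-1).
  apply: pser_cvg; [by rewrite invr_ge0 ltW| |].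
    by move=> i; rewrite rnorm_xcoef.
  by rewrite ltr_pdivrMr// mul1r.
suff F0 : F = 0 by rewrite -[X in _ --> X]F0.
apply/eqP; rewrite -rnorm_eq0 eq_le rnorm_ge0 andbT.
apply/ler_addgt0Pr => eps eps0; rewrite add0r.
have e20 : 0 < eps / 2 by rewrite divr_gt0.
move/cvg_rnormP : xF => /(_ _ e20)[N1 _ N1P].
have /cvgrPdist_lt/(_ _ e20)[N2 _ N2P] :=
  @cvg_geometric R (normc l ^+ K.+1 * rnorm y) _ q01.
have [n] := growth (maxn N1 N2); rewrite geq_max => /andP[nN1 nN2] hn.
have h1 := N1P (n + K).+1 (leq_trans nN1 (leqW (leq_addr _ _))).
have h2 := N2P n nN2.
have := pser_xcoef_le _ _ _ (n + K)%N xK l0 yx.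
rewrite (_ : ix (n + K)%N = n%:Z); last by lia.
move=> h3.
have h4 : rnorm (pser (xcoef x) l (n + K).+1) < eps / 2.
  apply: le_lt_trans h2; rewrite sub0r normrN /geometric/= ger0_norm; last first.
    by rewrite !mulr_ge0 ?exprn_ge0 ?rnorm_ge0// divr_ge0// ltW.
  rewrite expr_div_n mulrA ler_pdivlMr ?exprn_gt0//.
  rewrite mulrAC -exprD addSn [(K + n)%N]addnC.
  apply: le_trans h3; rewrite ler_wpM2l ?rnorm_ge0// ltW//.
rewrite -[F](subrK (pser (xcoef x) l (n + K).+1)) (le_trans (rnormD _ _))//.
rewrite ltW// (le_lt_trans (lerD (ltW h1) (lexx _)))//; lra.
Qed.

(** If the coordinate [n - 1] of the solutions vanishes near [0], the recursion
    bounds [|X_n|] by [|l| M / beta_n] for all small [l], so [X_n = 0]; then the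
    coordinate [n] of the solutions vanishes too, and the argument continues. *)
Lemma bounded_at0_eq0 x (f : R[i] -> H) (M delta : R) : supported x -> 0 < delta ->
  (forall l, normc l < delta -> S (f l) - l *: f l = x /\ rnorm (f l) <= M) ->
  x = 0.
Proof.
move=> xK d0 fP; apply: supported_eq0 => // i.
have step n : (forall l, l != 0 -> normc l < delta -> ncoord (f l) (n - 1) = 0) ->
    ncoord x n = 0.
  move=> y0; apply/eqP; rewrite -normc_eq0 eq_le normc_ge0 andbT.
  apply/ler_addgt0Pr => eps eps0; rewrite add0r.
  have b0 := wbeta_gt0 n.
  have M0 : 0 <= M.
    by apply: le_trans (fP 0 _).2; rewrite ?rnorm_ge0// Normc.normc0.
  (* [t] stays below [delta] and satisfies [t M <= eps * beta_n]. *)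
  pose t := Num.min (delta / 2) (eps * wbeta w n / (M + 1)).
  have t0 : 0 < t by rewrite lt_min !divr_gt0 ?mulr_gt0//; lra.
  have td : t < delta by rewrite /t gt_min; apply/orP; left; lra.
  have nt : normc t%:C%C = t by rewrite normc_real gtr0_norm.
  have [yx yM] : S (f t%:C%C) - t%:C%C *: f t%:C%C = x /\ rnorm (f t%:C%C) <= M.
    by apply: fP; rewrite nt.
  rewrite -yx ncoord_shift y0 ?nt//; last by rewrite (fmorph_eq0 (real_complex R)) gt_eqF.
  rewrite sub0r normcN Normc.normcM nt.
  have h := ncoord_le (f t%:C%C) n.
  have tM : t * (M + 1) <= eps * wbeta w n.
    by rewrite -ler_pdivlMr ?ge_min ?lexx ?orbT//; lra.
  rewrite -(ler_pM2r b0) -mulrA; apply: le_trans tM.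
  by rewrite ler_wpM2l ?(ltW t0)//; lra.
suff : forall l, l != 0 -> normc l < delta -> ncoord (f l) (ix i - 1) = 0 by exact: step.
elim: i => [|i IH] l l0 ld; have [yx _] := fP l ld.
  apply: (ncoord_left0 r2 _ _ _ (- K%:Z) l0 yx); last by lia.
  exact: supported_ncoord.
have := step _ IH; rewrite -yx ncoord_shift IH// sub0r => /eqP.
rewrite oppr_eq0 mulf_eq0 (negbTE l0)/= => /eqP.
by rewrite (_ : ix i.+1 - 1 = ix i); last by lia.
Qed.

End Necessary.

(** * Solutions outside the disc and their expansions *)

Section Sufficient.
(** Here [sigma] and [rho] stand for two numbers with
    [r3_plus w < sigma < rho < R_plus x]; the gap between them makes the series
    of the coordinates converge. *)
Variables (rho sigma D : R).
Hypothesis sigma0 : 0 < sigma.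
Hypothesis sigma_rho : sigma < rho.
Hypothesis wbetaD : forall i : nat, wbeta w (ix i) <= D * sigma ^+ i.

Let rho0 : 0 < rho. Proof. exact: lt_trans sigma_rho. Qed.

(** The vectors whose normalized coordinates have the decay that membership in
    the disc of convergence of radius [R_plus x] provides; the constant is kept
    explicit because it controls the size of Taylor coefficients. *)
Definition decays (C : R) x := supported x /\
  forall i : nat, normc (ncoord x (ix i)) <= C * rho^-1 ^+ i.

(** The series of the coordinates converges absolutely, with ratio [sigma / rho]. *)
Lemma decaying_vector (b : nat -> R[i]) (C : R) :
  (forall i, normc (b i) <= C * rho^-1 ^+ i) ->
  exists y, [/\ supported y, forall i : nat, ncoord y (ix i) = b i &
    rnorm y <= C * D / (1 - sigma / rho)].
Proof.
move=> bC.
pose u (i : nat) := (b i * (wbeta w (ix i))%:C%C) *: e (ix i).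
have [|n|y [uy yC]] := @geometric_series_cvg _ _ u (C * D) (sigma / rho).
- by rewrite divr_ge0 ?(ltW sigma0) ?(ltW rho0)//= ltr_pdivrMr// mul1r.
- rewrite rnormZ (rnorm_e _ _ dotP eP) mulr1 Normc.normcM normc_real.
  rewrite gtr0_norm ?wbeta_gt0// exprMn.
  rewrite [leRHS](_ : _ = (C * rho^-1 ^+ n) * (D * sigma ^+ n)); last by ring.
  by rewrite ler_pM ?normc_ge0// ltW// wbeta_gt0.
have uE n M : dot (series u M) (e n) =
    \sum_(j < M) b j * (wbeta w (ix j))%:C%C * (ix j == n)%:R.
  rewrite /series/= big_mkord linear_sumlz; apply: eq_bigr => j _.
  by rewrite linearZl_LR/= eP.1.
exists y; split=> // [n nK|i].
  apply: (coord_lim _ _ dotP eP _ _ _ _ uy); near=> M.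
  rewrite uE big1// => j _; case: eqP => [jn|_]; last by rewrite mulr0.
  by move: nK; rewrite -jn; lia.
rewrite /ncoord (coord_lim _ _ dotP eP _ _ _ (b i * (wbeta w (ix i))%:C%C) uy).
  by rewrite mulfK// (fmorph_eq0 (real_complex R)) gt_eqF// wbeta_gt0.
near=> M.
have iM : (i < M)%N by near: M; exact: nbhs_infty_gt.
rewrite uE (bigD1 (Ordinal iM))//= eqxx mulr1 big1 ?addr0// => j ji.
case: eqP => [jn|_]; last by rewrite mulr0.
by move/eqP : ji; case; apply: val_inj => /=; lia.
Unshelve. all: by end_near. Qed.

Lemma supported_inj x y : supported x -> supported y ->
  (forall i : nat, ncoord x (ix i) = ncoord y (ix i)) -> x = y.
Proof.
move=> xK yK xy; apply/eqP; rewrite -subr_eq0; apply/eqP/supported_eq0.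
  by move=> n nK; rewrite linearBl/= xK// yK// subr0.
by move=> i; rewrite /ncoord linearBl/= mulrBl -/(ncoord _ _) xy subrr.
Qed.

Lemma decays_rnorm C x : decays C x -> rnorm x <= C * D / (1 - sigma / rho).
Proof.
move=> [xK xC]; have [y [yK yx yC]] := decaying_vector _ _ xC.
by rewrite (supported_inj x y).
Qed.

(** The recursion [Y_(n-1) - l Y_n = X_n] solved from the left end. *)
Fixpoint resolvent_seq l (b : nat -> R[i]) (i : nat) : R[i] :=
  if i is j.+1 then (resolvent_seq l b j - b i) / l else - b 0%N / l.

(** The constant is the fixed point of the induction:
    [(C / (|l| - rho) + C / rho) / |l| = C / (|l| - rho) / rho]. *)
Lemma resolvent_seq_le l (b : nat -> R[i]) (C : R) : rho < normc l ->
  (forall i, normc (b i) <= C * rho^-1 ^+ i) ->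
  forall i, normc (resolvent_seq l b i) <= C / (normc l - rho) * rho^-1 ^+ i.
Proof.
move=> rl bC.
have C0 : 0 <= C by have := bC 0%N; rewrite expr0 mulr1; apply: le_trans (normc_ge0 _).
have g0 : 0 < normc l - rho by rewrite subr_gt0.
have l0 : 0 < normc l by exact: lt_trans rl.
elim=> [|i IH]/=; rewrite Normc.normcM Normc.normcV ler_pdivrMr//.
  rewrite normcN (le_trans (bC 0%N))// !expr0 !mulr1 -mulrA ler_peMr//.
  by rewrite mulrC ler_pdivlMr// mul1r gerBl ltW.
apply: le_trans (normcB _ _) _; apply: le_trans (lerD IH (bC i.+1)) _.
rewrite le_eqVlt; apply/orP; left; apply/eqP; rewrite exprS; field.
by rewrite (gt_eqF rho0) (gt_eqF g0).
Qed.

(** The solution does not depend on [C], so the bound may be used with every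
    constant that is valid for [x]. *)
Lemma decays_solve l x : rho < normc l -> exists y, forall C, decays C x ->
  S y - l *: y = x /\ decays (C / (normc l - rho)) y.
Proof.
move=> rl.
have l0 : l != 0 by rewrite -normc_eq0 gt_eqF// (lt_trans rho0).
have [[C0 [xK xC0]]|nx] := pselect (exists C, decays C x); last first.
  by exists 0 => C xC; case: nx; exists C.
pose b := resolvent_seq l (fun i => ncoord x (ix i)).
have [y [yK yb _]] := decaying_vector b _ (resolvent_seq_le _ _ _ rl xC0).
exists y => C [_ xC]; split; last first.
  by split=> // i; rewrite yb; exact: resolvent_seq_le.
have yK' := supported_ncoord _ yK; have xK' := supported_ncoord _ xK.
apply: ncoord_inj => n; rewrite ncoord_shift.
have [nK|nK] := ltP n (- K%:Z).
  by rewrite xK'// yK' ?yK'//; [rewrite mulr0 subr0|lia].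
have -> : n = ix (absz (n + K%:Z)) by lia.
case: (absz _) => [|i].
  by rewrite yb yK' /b/=; [rewrite sub0r; field|lia].
rewrite (_ : ix i.+1 - 1 = ix i); last by lia.
by rewrite !yb /b/=; field.
Qed.

Section Analytic.
Hypothesis r2 : r2_minus w = 0%E.

(** With [G] a solution operator at [l0] that preserves decay, the Taylor
    coefficients at [l0] are [G x, G (G x), ...].  The partial sums solve the
    equation at [l] up to the error [(l - l0) ^ M G^M x], which tends to [0], so
    the sum is a solution, and the uniqueness of solutions identifies it with
    [f l]. *)
Lemma decays_analytic l0 x C (f : R[i] -> H) : rho < normc l0 -> decays C x ->
  (forall l, rho < normc l -> S (f l) - l *: f l = x) ->
  exists c : nat -> H, exists2 eta : R, 0 < eta &
    forall l, normc (l - l0) < eta -> pser c (l - l0) @ \oo --> f l.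
Proof.
move=> rl0 xC fx.
have /choice[G GP] : forall z, exists y, forall C, decays C z ->
    S y - l0 *: y = z /\ decays (C / (normc l0 - rho)) y.
  by move=> z; exact: decays_solve.
pose kap := (normc l0 - rho)^-1.
have kap0 : 0 < kap by rewrite invr_gt0 subr_gt0.
pose c (n : nat) := iter n G x.
have cC (n : nat) : decays (C * kap ^+ n) (c n).
  elim: n => [|n IH]; first by rewrite expr0 mulr1.
  by rewrite exprSr mulrA; exact: (GP _ _ IH).2.
have cS (n : nat) : S (c n.+1) = l0 *: c n.+1 + c n.
  by rewrite -(GP _ _ (cC n)).1 addrC subrK.
exists (fun n : nat => c n.+1); exists (kap^-1); first by rewrite invr_gt0.
move=> l; set h := l - l0 => hk.
have hk1 : normc h * kap < 1 by rewrite -ltr_pdivlMr// div1r.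
have cB (n : nat) : rnorm (c n) <= C * D / (1 - sigma / rho) * kap ^+ n.
  by apply: le_trans (decays_rnorm _ _ (cC n)) _; rewrite le_eqVlt; apply/orP; left; apply/eqP; ring.
have [y [cy _]] : exists y, pser (fun n : nat => c n.+1) h @ \oo --> y /\
    rnorm y <= C * D / (1 - sigma / rho) * kap / (1 - normc h * kap).
  by apply: pser_cvg => [|i|//]; [exact: ltW|rewrite -mulrA -exprS].
have rl : rho < normc l.
  move: hk; rewrite /kap invrK => hk.
  have := normcB l h; rewrite (_ : l - h = l0); first lra.
  by rewrite /h opprB addrC subrK.
suff yx : S y - l *: y = x.
  have lN0 : l != 0 by rewrite -normc_eq0 gt_eqF// (lt_trans rho0).
  by rewrite -(solution_unique r2 _ _ _ _ lN0 yx (fx _ rl)).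
have partial M : S (pser (fun n : nat => c n.+1) h M) - l *: pser (fun n : nat => c n.+1) h M =
    x - h ^+ M *: c M.
  elim: M => [|M IH].
    by rewrite /pser /series/= big_geq// linear0 scaler0 expr0 scale1r !subrr.
  have term : S (h ^+ M *: c M.+1) - l *: (h ^+ M *: c M.+1) =
      h ^+ M *: c M - h ^+ M.+1 *: c M.+1.
    have -> : S (h ^+ M *: c M.+1) = h ^+ M *: (l0 *: c M.+1 + c M).
      by rewrite -cS linearZ.
    have -> : l = l0 + h by rewrite /h addrC subrK.
    rewrite scalerDr scalerDl !scalerA exprS [l0 * _]mulrC opprD addrA.
    by rewrite [_ + h ^+ M *: c M]addrC addrK.
  by rewrite !pser_recr linearD scalerDr opprD addrACA IH term addrA subrK.
have lim1 : (fun M => S (pser (fun n : nat => c n.+1) h M) -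
    l *: pser (fun n : nat => c n.+1) h M) @ \oo --> S y - l *: y.
  by apply: cvgB; [apply: continuous_cvg => //; exact: Se.1|exact: cvgZr].
have lim2 : (fun M => S (pser (fun n : nat => c n.+1) h M) -
    l *: pser (fun n : nat => c n.+1) h M) @ \oo --> x - 0.
  rewrite (funext partial); apply: cvgB; first exact: cvg_cst.
  pose v (n : nat) := C * D / (1 - sigma / rho) * (normc h * kap) ^+ n.
  apply: (@cvg_rnorm0 _ _ _ v) => [n|].
    by rewrite rnormZ normcX /v exprMn mulrCA ler_wpM2l ?exprn_ge0 ?normc_ge0.
  have hk0 : 0 <= normc h * kap by rewrite mulr_ge0 ?normc_ge0 ?(ltW kap0).
  by apply: cvg_geometric; rewrite ger0_norm.
by rewrite -[RHS]subr0; apply: (cvg_unique _ lim1 lim2).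
Qed.

End Analytic.
End Sufficient.
End Supported.
End Shift.

(** * The two radii and the local spectrum *)

Section Radii.
Context {R : realType} {H : completeNormedModType R[i]}.
Context (dot : {dot H for Num.conj}) (e : int -> H) (w : int -> R).
Hypothesis w0 : forall n : int, 0 < w n.
Local Notation normc := Normc.normc.

Lemma nbhs_normcP (l : R[i]^o) (U : set R[i]^o) : nbhs l U <->
  exists2 d : R, 0 < d & forall z, normc (z - l) < d -> U z.
Proof.
split=> [/nbhs_normP[d d0 dU]|[d d0 dU]].
  have dE : d = (complex.Re d)%:C%C by rewrite RRe_real// gtr0_real.
  exists (complex.Re d); first by rewrite -ltcR -dE.
  by move=> z zl; apply: dU => /=; rewrite distrC normc_normE dE ltcR.
apply/(@nbhs_normP _ R[i]^o); exists d%:C%C; first by rewrite /= ltcR.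
by move=> z /=; rewrite distrC normc_normE ltcR; exact: dU.
Qed.

(** Re-indexing by [i = n + K] multiplies a geometric bound by a constant. *)
Lemma geometric_bound_shift (v : int -> R) (q : R) (K : nat) : 0 < q ->
  (\forall n \near \oo, v n%:Z <= q ^+ n) ->
  exists C, forall i : nat, v (i%:Z - K%:Z) <= C * q ^+ i.
Proof.
move=> q0 [N _ vN].
apply: (geometric_bound_near (fun i : nat => v (i%:Z - K%:Z)) (q^-1 ^+ K)) => //.
exists (N + K)%N => // i /= Ni.
have Ki : (K <= i)%N by apply: leq_trans Ni; rewrite leq_addl.
rewrite (_ : i%:Z - K%:Z = (i - K)%N%:Z); last by lia.
rewrite (le_trans (vN _ _)) //=; first by rewrite leq_subRL// addnC.
by rewrite -{2}(subnKC Ki) exprD mulrA -exprMn mulVf ?gt_eqF// expr1n mul1r.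
Qed.

Lemma R_plus_bound x (rho : R) : 0 < rho -> (rho%:E < R_plus w dot e x)%E ->
  \forall n \near \oo, normc (ncoord dot e w x n%:Z) <= rho^-1 ^+ n.
Proof.
move=> rho0 /lt_limn_einf h; near=> n.
have n0 : (0 < n)%N by near: n; exact: nbhs_infty_gt.
have /= : (rho%:E < if dot x (e n%:Z) == 0%R then +oo%E
    else (normc ((wbeta w n%:Z)%:C%C / dot x (e n%:Z)) `^ n%:R^-1)%:E)%E by near: n.
rewrite /ncoord; case: eqP => [-> _|/eqP a0].
  by rewrite mul0r Normc.normc0 exprn_ge0// invr_ge0 ltW.
rewrite lte_fin lt_root ?normc_ge0 ?(ltW rho0)// => rb.
rewrite -[X in normc X]invrK Normc.normcV exprVn lef_pV2 ?posrE.
- by rewrite invfM invrK mulrC ltW.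
- by rewrite invfM invrK mulrC; apply: lt_trans rb; rewrite exprn_gt0.
- by rewrite exprn_gt0.
Unshelve. all: by end_near. Qed.

Lemma r3_plus_bound (sigma : R) : 0 < sigma -> (r3_plus w < sigma%:E)%E ->
  \forall n \near \oo, wbeta w n%:Z <= sigma ^+ n.
Proof.
move=> s0 /limn_esup_lt h; near=> n.
have n0 : (0 < n)%N by near: n; exact: nbhs_infty_gt.
have : ((wbeta w n%:Z `^ n%:R^-1)%:E < sigma%:E)%E by near: n.
by rewrite lte_fin root_lt ?(ltW s0)//; [exact: ltW|exact/ltW/wbeta_gt0].
Unshelve. all: by end_near. Qed.

Lemma r3_plus_growth (rho : R) : 0 <= rho -> (rho%:E < r3_plus w)%E ->
  forall N, exists2 n : nat, (N <= n)%N & rho ^+ n < wbeta w n%:Z.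
Proof.
move=> rho0 /lt_limn_esup h N; have [n Nn] := h N.+1.
rewrite lte_fin lt_root ?(leq_ltn_trans _ Nn)//; last exact/ltW/wbeta_gt0.
by exists n => //; exact: ltnW.
Qed.

Lemma r3_plus_ge0 : (0 <= r3_plus w)%E.
Proof.
rewrite /r3_plus /limn_esup; apply: limf_esup_ge0 => [[N _ /(_ N)]|n].
  by move=> /(_ (leqnn N)).
by rewrite lee_fin powR_ge0.
Qed.

(** Convergence of the expansion at [0] at one non-zero point bounds its
    coefficients geometrically, hence its sums on a smaller disc. *)
Lemma analytic_bounded0 (U : set R[i]^o) (f : R[i]^o -> H) : analytic_on U f -> U 0 ->
  exists M : R, exists2 d : R, 0 < d & forall l, normc l < d -> rnorm (f l) <= M.
Proof.
move=> fU /fU[c /nbhs_normcP[d d0 cf]].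
have pf l : normc l < d -> pser c l @ \oo --> f l.
  by move=> ld; have := cf l; rewrite !subr0 => /(_ ld).
have d20 : 0 < d / 2 by rewrite divr_gt0.
have nd : normc (d / 2)%:C%C = d / 2 by rewrite normc_real gtr0_norm.
have c0 : (fun n => (d / 2)%:C%C ^+ n *: c n) @ \oo --> (0 : H).
  apply: (@cvg_series_cvg_0 _ H); apply: cvgP (pf (d / 2)%:C%C _); rewrite nd; lra.
have [C cC] : exists C, forall n, rnorm (c n) <= C * (d / 2)^-1 ^+ n.
  apply: (geometric_bound_near (fun n => rnorm (c n)) 1); first by rewrite invr_gt0.
  move/cvg_rnormP : c0 => /(_ 1 ltr01); apply: filterS => n.
  rewrite sub0r rnormN rnormZ normcX nd mul1r => h.
  by rewrite exprVn -[leRHS]mul1r ler_pdivlMr ?exprn_gt0// mulrC ltW.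
exists (C / 2^-1), (d / 4); first by rewrite divr_gt0.
move=> l ld.
have l2 : normc l * (d / 2)^-1 <= 2^-1.
  by rewrite ler_pdivrMr//; lra.
have l1 : normc l * (d / 2)^-1 < 1 by lra.
have d20' : 0 <= (d / 2)^-1 by rewrite invr_ge0 ltW.
have [y [cy yC]] := pser_cvg _ _ _ _ d20' cC l1.
have <- : y = f l.
  by apply: (cvg_unique _ cy (pf _ _)) => //; lra.
apply: le_trans yC _.
have C0 : 0 <= C by have := cC 0%N; rewrite expr0 mulr1; apply: le_trans (rnorm_ge0 _).
by rewrite ler_wpM2l// lef_pV2 ?posrE; lra.
Qed.

End Radii.

Section LocalSpectrum.
Context {R : realType} {H : completeNormedModType R[i]}.
Context (dot : {dot H for Num.conj}) (e : int -> H).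
Context (w : int -> R) (S : {linear H -> H}) (K : nat) (x : H).
Hypothesis dotP : inner_product dot.
Hypothesis eP : orthonormal_basis dot e.
Hypothesis w0 : forall n : int, 0 < w n.
Hypothesis Se : bilateral_weighted_shift e w S.
Hypothesis r2 : r2_minus w = 0%E.
Hypothesis xK : forall n, n < - K%:Z -> dot x (e n) = 0.
Hypothesis xn0 : x != 0.
Local Notation normc := Normc.normc.

(** A point [l != 0] is replaced by a ball around [mu = (1 - 2 th) l] that lies in
    the domain of the local solution and strictly inside the disc of radius
    [|l|], away from [0]. *)
Lemma disc_sub_local_spectrum (l : R[i]^o) :
  ((normc l)%:E <= r3_plus w)%E -> ((normc l)%:E <= R_plus w dot e x)%E ->
  local_spectrum S x l.
Proof.
move=> lr3 lR [U [Uo [f [fan fx]]] Ul].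
have /nbhs_normcP[d d0 dU] : nbhs l U by exact: open_nbhs_nbhs.
apply/negP: xn0; rewrite negbK; apply/eqP.
have [l0|l0] := eqVneq l 0.
  rewrite {}l0 in Ul dU *.
  have [M [d' d'0 fM]] := analytic_bounded0 _ _ fan Ul.
  apply: (bounded_at0_eq0 _ _ w S dotP eP w0 Se K r2 x f M (Num.min d d')) => //.
    by rewrite lt_min d0.
  move=> z; rewrite lt_min => /andP[zd zd']; split; last exact: fM.
  by apply: fx; apply: dU; rewrite subr0.
have nl0 : 0 < normc l by rewrite lt_neqAle eq_sym normc_eq0 l0 normc_ge0.
(* [th <= 1 / 4] keeps the ball of radius [th |l|] around [mu] away from [0], and
   [3 th |l| <= d] keeps it in the domain of [f]. *)
pose th := Num.min (1 / 4) (d / (3 * normc l)).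
have th0 : 0 < th by rewrite lt_min !divr_gt0 ?mulr_gt0//; lra.
have th4 : th <= 1 / 4 by rewrite ge_min lexx.
have thd : 3 * (th * normc l) <= d.
  by rewrite mulrCA -ler_pdivlMr ?mulr_gt0// ge_min lexx orbT.
pose rho := (1 - th) * normc l.
have rho0 : 0 < rho by rewrite mulr_gt0//; lra.
have rhol : rho < normc l by rewrite gtr_pMl//; lra.
pose mu : R[i] := (1 - 2 * th)%:C%C * l.
have nmu : normc mu = (1 - 2 * th) * normc l.
  by rewrite Normc.normcM normc_real ger0_norm//; lra.
have mul : normc (mu - l) = 2 * (th * normc l).
  have -> : mu - l = - ((2 * th)%:C%C * l) by rewrite /mu rmorphB rmorph1; ring.
  by rewrite normcN Normc.normcM normc_real ger0_norm ?mulrA//; lra.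
have rhoV0 : 0 < rho^-1 by rewrite invr_gt0.
have rhoR : (rho%:E < R_plus w dot e x)%E by apply: lt_le_trans lR; rewrite lte_fin.
have rhor3 : (rho%:E < r3_plus w)%E by apply: lt_le_trans lr3; rewrite lte_fin.
have [C xC] := geometric_bound_shift (fun n => normc (ncoord dot e w x n)) _ K rhoV0
  (R_plus_bound dot e w x rho rho0 rhoR).
have growth := r3_plus_growth w w0 rho (ltW rho0) rhor3.
have thl : 0 < th * normc l by rewrite mulr_gt0.
have xc0 : forall i, xcoef dot e w K x i = 0.
  apply: (identity_theorem _ mu C rho^-1); first by rewrite invr_gt0.
  - by move=> i; rewrite rnorm_xcoef.
  - by rewrite ltr_pdivrMr// mul1r nmu /rho; lra.
  exists (th * normc l) => // z zmu.
  have zl : normc (z - l) < d.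
    have : normc (z - l) <= normc (z - mu) + normc (mu - l).
      by rewrite (le_trans _ (le_normcD _ _))// addrA subrK.
    lra.
  have zrho : normc z < rho.
    have : normc z <= normc (z - mu) + normc mu.
      by rewrite -{1}[z](subrK mu) le_normcD.
    rewrite nmu /rho; lra.
  have z0 : z != 0.
    apply/eqP => z0; move: zmu; rewrite z0 sub0r normcN nmu; nra.
  exact: (pser_xcoef_vanish _ _ w S dotP eP w0 Se K r2 z x _ C rho xK z0 (fx _ (dU _ zl)) zrho).
apply: (supported_eq0 _ _ w dotP eP w0 K x xK) => i.
by apply/eqP; rewrite -normc_eq0 -(rnorm_xcoef _ _ w dotP eP) xc0 rnorm0.
Qed.

(** On the complement of the disc, the solution exists by [decays_solve], is
    unique, and is analytic at each point; the rates [sigma] and [rho] depend on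
    the point. *)
Lemma local_spectrum_sub_disc : (r3_plus w < R_plus w dot e x)%E ->
  local_spectrum S x `<=` closed_disc (r3_plus w).
Proof.
move=> r3R l; apply: contra_notP => /negP; rewrite -ltNge => lr3.
have [r rE] : exists r, r3_plus w = r%:E.
  exists (fine (r3_plus w)); rewrite fineK// ge0_fin_numE ?r3_plus_ge0//.
  by apply: lt_le_trans r3R _; rewrite leey.
have r0 : 0 <= r by rewrite -lee_fin -rE r3_plus_ge0.
have annulus (z : R[i]) : r < normc z -> exists rho sigma C D : R,
    [/\ 0 < sigma, sigma < rho, r < rho < normc z, decays dot e w K rho C x &
      forall i : nat, wbeta w (i%:Z - K%:Z) <= D * sigma ^+ i].
  move=> rz.
  have [m [rm mz mR]] : exists m : R, [/\ r < m, m <= normc z & (m%:E <= R_plus w dot e x)%E].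
    move: r3R; rewrite rE; case: (R_plus w dot e x) => [s|_|//].
      rewrite lte_fin => rs; exists (Num.min (normc z) s).
      by rewrite lt_min rz rs ge_min lexx lee_fin ge_min lexx orbT.
    by exists (normc z); rewrite rz lexx leey.
  pose sigma := (2 * r + m) / 3; pose rho := (r + 2 * m) / 3.
  have s0 : 0 < sigma by rewrite /sigma; lra.
  have sr : sigma < rho by rewrite /sigma /rho; lra.
  have rho0 : 0 < rho by lra.
  have rhoV0 : 0 < rho^-1 by rewrite invr_gt0.
  have rhoR : (rho%:E < R_plus w dot e x)%E.
    by apply: lt_le_trans mR; rewrite lte_fin /rho; lra.
  have rsigma : (r3_plus w < sigma%:E)%E by rewrite rE lte_fin /sigma; lra.
  have [C xC] := geometric_bound_shift (fun n => normc (ncoord dot e w x n)) _ K rhoV0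
    (R_plus_bound dot e w x rho rho0 rhoR).
  have [D wD] := geometric_bound_shift (wbeta w) sigma K s0
    (r3_plus_bound w w0 sigma s0 rsigma).
  by exists rho, sigma, C, D; split=> //; apply/andP; split; rewrite /rho; lra.
have /choice[f fP] : forall z : R[i], exists y, r < normc z -> S y - z *: y = x.
  move=> z; have [rz|_] := boolP (r < normc z); last by exists 0.
  have [rho [sigma [C [D [s0 sr /andP[rrho rhoz] xC wD]]]]] := annulus z rz.
  have [y yP] := decays_solve _ _ w S dotP eP w0 Se K rho sigma D s0 sr wD z x rhoz.
  by exists y => _; have [] := yP _ xC.
exists [set z : R[i]^o | r < normc z]; last by move: lr3; rewrite rE lte_fin.
split.
  rewrite openE => z /= rz; apply/nbhs_normcP.
  exists (normc z - r); first by rewrite subr_gt0.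
  move=> z' zz' /=.
  have := normcB z' (z' - z); rewrite opprB addrC subrK; lra.
exists f; split; last by move=> z; exact: fP.
move=> z rz.
have [rho [sigma [C [D [s0 sr /andP[rrho rhoz] xC wD]]]]] := annulus z rz.
have [c [eta eta0 cP]] := decays_analytic _ _ w S dotP eP w0 Se K rho sigma D s0 sr wD r2
  z x C f rhoz xC (fun z' rz' => fP z' (lt_trans rrho rz')).
by exists c; apply/nbhs_normcP; exists eta.
Qed.

End LocalSpectrum.

Theorem theorem4p8 (R : realType) (H : completeNormedModType R[i])
    (dot : {dot H for Num.conj}) (e : int -> H)
    (w : int -> R) (S : {linear H -> H}) (k : int) (x : H) :
  inner_product dot ->
  orthonormal_basis dot e ->
  (forall n : int, 0 < w n) ->
  (exists M : R, forall n : int, w n <= M) ->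
  bilateral_weighted_shift e w S ->
  r2_minus w = 0%E ->
  closed_span [set e n | n in [set n : int | k <= n]] x ->
  x != 0 ->
  ((r3_plus w < R_plus w dot e x)%E ->
     local_spectrum S x = closed_disc (r3_plus w)) /\
  ((R_plus w dot e x <= r3_plus w)%E ->
     closed_disc (R_plus w dot e x) `<=` local_spectrum S x).
Proof.
move=> dotP eP w0 _ Se r2 xk xn0.
have xK n : n < - `|k|%N%:Z -> dot x (e n) = 0.
  by move=> nk; apply: (coord_supp _ _ dotP eP _ _ _ xk) => /= kn; lia.
have disc (l : R[i]^o) : ((Normc.normc l)%:E <= r3_plus w)%E ->
    ((Normc.normc l)%:E <= R_plus w dot e x)%E -> local_spectrum S x l.
  exact: (disc_sub_local_spectrum _ _ w S _ x dotP eP w0 Se r2 xK xn0).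
split=> [r3R|Rr3 l lR]; last exact: disc (le_trans lR Rr3) lR.
apply/seteqP; split.
  exact: (local_spectrum_sub_disc _ _ w S _ x dotP eP w0 Se r2 xK r3R).
by move=> l lr3; exact: disc lr3 (le_trans lr3 (ltW r3R)).
Qed.
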